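(* Let $S\subset\mathbb{R}^2$ be a finite set of sites and let $\mathcal{D}$ be a Delaunay triangulation region of $S$. Then $\mathcal{D}$ has a local Leader uniform topology.
   Context: For $p\in S$, the Voronoi region of $p$ is $V_p=\{x\in\mathbb{R}^2:\|x-p\|\le\|x-q\|\text{ for all }q\in S\}$. For $p,q\in S$, the straight segment $\overline{pq}$ is a Delaunay edge if and only if $V_p$ and $V_q$ intersect along a common line segment. A triangle $\bigtriangleup(pqr)$ with vertices $p,q,r\in S$ is a Delaunay triangle provided its edges are Delaunay edges. Two Delaunay triangles are strongly near if they have a common edge. A Delaunay triangulation region $\mathcal{D}$ is a collection of Delaunay triangles such that every pair of triangles in the collection is strongly near. For $A,B\subset\mathbb{R}^2$, $A$ is near (close to) $B$, written $A\ \delta\ B$, provided $\mathrm{cl}A\cap\mathrm{cl}B\neq\emptyset$. A local Leader uniform topology on a set in the plane is the topology determined by finding those sets that are close to each given set; for $\mathcal{D}$ this means that each given $A\in\mathcal{D}$ is assigned the family $\{B\in\mathcal{D}: A\ \delta\ B\}$ of all members of $\mathcal{D}$ close to $A$. *)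

(* Defs.v *)
From HB Require Import structures.
From mathcomp Require Import all_boot all_order all_algebra.
From mathcomp Require Import all_classical all_reals all_analysis.

Set Implicit Arguments.
Unset Strict Implicit.
Unset Printing Implicit Defensive.

Import Order.TTheory GRing.Theory Num.Theory.
Import numFieldNormedType.Exports.
Local Open Scope classical_set_scope.
Local Open Scope ring_scope.

Notation plane R := 'rV[R]_2.

(* The canonical norm [`|x|] on ['rV[R]_2] is the sup norm, which gives the
   right topology but the wrong Voronoi regions. *)
Definition enorm (R : realType) (x : plane R) : R :=
  Num.sqrt (\sum_(i < 2) x ord0 i ^+ 2).

Definition segment (R : realType) (p q : plane R) : set (plane R) :=
  [set x | exists2 t : R, 0 <= t <= 1 & x = (1 - t) *: p + t *: q].

Definition triangle (R : realType) (p q r : plane R) : set (plane R) :=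
  [set x | exists a b c : R, [/\ 0 <= a, 0 <= b, 0 <= c, a + b + c = 1
                               & x = a *: p + b *: q + c *: r]].

Definition voronoi (R : realType) (S : set (plane R)) (p : plane R) :
    set (plane R) :=
  [set x | forall q, S q -> enorm (x - p) <= enorm (x - q)].

(* [voronoi S p] and [voronoi S q] are required to meet along a nondegenerate
   segment; asking for the intersection to be exactly a (bounded) segment would
   lose the hull edges, whose Voronoi regions meet along a ray or a line. *)
Definition delaunay_edge (R : realType) (S : set (plane R)) (p q : plane R) :=
  [/\ S p, S q, p != q &
      exists a b : plane R,
        a != b /\ segment a b `<=` voronoi S p `&` voronoi S q].

(* Three collinear sites never have pairwise Delaunay edges, so these triangles
   are nondegenerate. *)
Definition delaunay_vertices (R : realType) (S : set (plane R))
    (p q r : plane R) :=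
  [/\ delaunay_edge S p q, delaunay_edge S q r & delaunay_edge S r p].

Definition delaunay_triangle (R : realType) (S : set (plane R))
    (A : set (plane R)) :=
  exists p q r, delaunay_vertices S p q r /\ A = triangle p q r.

(* [p], [q], [r] range over all orderings of the vertices, so [segment p q]
   ranges over the three edges. *)
Definition triangle_edge (R : realType) (S : set (plane R))
    (A e : set (plane R)) :=
  exists p q r,
    [/\ delaunay_vertices S p q r, A = triangle p q r & e = segment p q].

Definition strongly_near (R : realType) (S : set (plane R))
    (A B : set (plane R)) :=
  exists e, triangle_edge S A e /\ triangle_edge S B e.

Definition delaunay_region (R : realType) (S : set (plane R))
    (D : set (set (plane R))) :=
  (forall A, D A -> delaunay_triangle S A) /\
  (forall A B, D A -> D B -> A != B -> strongly_near S A B).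

Definition near_sets (R : realType) (A B : set (plane R)) :=
  closure A `&` closure B !=set0.

Definition close_family (R : realType) (D : set (set (plane R))) (A : D) :
    set D :=
  [set B : D | near_sets (val A) (val B)].

(* A uniform structure on the bare type [X], and [X] equipped with it. *)
Definition uniformity (X : choiceType) : Type :=
  isUniform.axioms_ X (Choice.class X) (Choice.class X).
Definition uniform_space (X : choiceType) (u : uniformity X) : uniformType :=
  let u' : isUniform.axioms_ X (Choice.class X) (Choice.class X) := u in
  HB.pack X u'.

(* A uniform topology on the collection [D] which is determined by the
   assignment of [close_family A] to each [A]: the neighbourhoods of [A] are
   exactly the supersets of [close_family A]. *)
Definition local_leader_uniform_topology (R : realType)
    (D : set (set (plane R))) (u : uniformity (set_type D)) :=
  forall (A : D) (P : set D),
    nbhs (A : uniform_space u) P <-> close_family A `<=` P.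

(* Main.v *)
Require Import Defs.
From HB Require Import structures.
From mathcomp Require Import all_boot all_order all_algebra.
From mathcomp Require Import all_classical all_reals all_analysis.

Set Implicit Arguments.
Unset Strict Implicit.
Unset Printing Implicit Defensive.

(** Any two members of a Delaunay triangulation region are equal or share an
edge, so they have a point in common and are close to each other
([delaunay_region_near]). The family of members close to a given one is thus
always the whole region: closeness is the full relation, which is in particular
an equivalence relation. The uniformity whose only entourage is the full
relation then does the job: it induces the indiscrete topology
([nbhs_indiscrete]), in which the only neighbourhood of any triangle is the
whole region, i.e. its family of close triangles. *)

Import Order.TTheory GRing.Theory Num.Theory.
Import numFieldNormedType.Exports.
Local Open Scope classical_set_scope.
Local Open Scope ring_scope.

Lemma segment_left (R : realType) (p q : plane R) : segment p q p.
Proof. by exists 0; rewrite ?lexx ?ler01 // subr0 scale1r scale0r addr0. Qed.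

Lemma segment_subset_triangle (R : realType) (p q r : plane R) :
  segment p q `<=` triangle p q r.
Proof.
move=> x [t /andP[t0 t1] ->]; exists (1 - t), t, 0.
by split; rewrite ?subr_ge0 ?addr0 ?subrK // scale0r addr0.
Qed.

Lemma meet_near_sets (R : realType) (A B : set (plane R)) :
  A `&` B !=set0 -> near_sets A B.
Proof. by move=> [x [Ax Bx]]; exists x; split; apply: subset_closure. Qed.

Lemma delaunay_triangle_nonempty (R : realType) (S A : set (plane R)) :
  delaunay_triangle S A -> A !=set0.
Proof.
move=> [p [q [r [_ ->]]]]; exists p.
exact/segment_subset_triangle/segment_left.
Qed.

Lemma strongly_near_meet (R : realType) (S A B : set (plane R)) :
  strongly_near S A B -> A `&` B !=set0.
Proof.
move=> [e [[p [q [r [_ -> epq]]]] [p' [q' [r' [_ -> epq']]]]]].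
have ep : e p by rewrite epq; exact: segment_left.
by exists p; split; apply: segment_subset_triangle; rewrite -?epq -?epq'.
Qed.

(** Strong nearness is only given for distinct members; a triangle is close to
itself because it is nonempty. *)
Lemma delaunay_region_near (R : realType) (S : set (plane R))
    (D : set (set (plane R))) (A B : set (plane R)) :
  delaunay_region S D -> D A -> D B -> near_sets A B.
Proof.
move=> [Dtri Dnear] DA DB; apply: meet_near_sets.
have [<-|AB] := eqVneq A B; last exact/strongly_near_meet/(Dnear A B).
by rewrite setIid; exact/delaunay_triangle_nonempty/(Dtri A).
Qed.

(** The filter [globally setT] contains the full relation only. *)
Definition indiscrete_uniformity (X : choiceType) : uniformity X.
Proof.
apply: (@isUniform.Axioms_ X _ _ (globally [set: X * X])).
- by move=> E ET x _; exact: ET.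
- by move=> E ET x _; exact: ET.
- by move=> E ET; exists setT => // x _; exact: ET.
Defined.

Lemma nbhs_indiscrete (X : choiceType) (x : X) (P : set X) :
  nbhs (x : uniform_space (indiscrete_uniformity X)) P <-> [set: X] `<=` P.
Proof.
rewrite -nbhs_entourageE; split.
- by move=> [E ET EP] y _; apply: EP; apply/mem_set; exact: ET.
- by move=> TP; exists setT => // y _; exact: TP.
Qed.

Theorem theorem3p6 (R : realType) (S : set (plane R))
    (D : set (set (plane R))) :
  finite_set S ->
  delaunay_region S D ->
  exists u : uniformity (set_type D), local_leader_uniform_topology u.
Proof.
move=> _ SD; exists (indiscrete_uniformity (set_type D)) => A P.
suff -> : close_family A = setT by exact: nbhs_indiscrete.
apply/seteqP; split=> // B _.
by apply: (delaunay_region_near SD); apply: set_valP.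
Qed.
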